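(* Let $n\ge 1$ and let $\mathbf{N}^{n+1}=[r_0,\bar r)\times\mathbb{S}^n$ be a rotationally symmetric space with metric $\bar g=dr^2+\phi^2(r)\sigma$, where $\phi,\phi'>0$ and $(\phi')^2-\phi\phi''\ge 0$. Let $\Omega\subset\mathbf{N}^{n+1}$ be a bounded domain enclosed by $S(r_0)$ and a graphical hypersurface $M$, and let $\alpha\in\mathbb{R}$. Then $$V_\phi^\alpha(\Omega)\le\xi_\alpha(V_\phi(\Omega))\quad\text{if }\phi''(\alpha-1)<0,$$ $$V_\phi^\alpha(\Omega)\ge\xi_\alpha(V_\phi(\Omega))\quad\text{if }\phi''(\alpha-1)>0.$$ Equality holds in either inequality (in its respective case) if and only if $\Omega=B(r)$ for some $r$.
   Context: Here $r_0\ge 0$, $\bar r\in(r_0,+\infty]$, $\sigma$ is the round metric on $\mathbb{S}^n$, $\phi$ is a smooth function of $r$, and the sign conditions on $\phi''(\alpha-1)$ are understood on $[r_0,\bar r)$. $S(r)=\{r\}\times\mathbb{S}^n$ and $B(r)=[r_0,r]\times\mathbb{S}^n$. A hypersurface $M$ is graphical if $M=\{(r(\theta),\theta):\theta\in\mathbb{S}^n\}\subset[r_0,\bar r)\times\mathbb{S}^n$ for a smooth positive function $r(\theta)$ on $\mathbb{S}^n$. The weighted $\alpha$-volume is $V_\phi^\alpha(\Omega)=\int_\Omega(\phi')^\alpha\,dv$, and $V_\phi(\Omega)=V_\phi^1(\Omega)$. Write $V_\phi^\alpha(r)=V_\phi^\alpha(B(r))$ and $V_\phi(r)=V_\phi(B(r))$,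 which are strictly increasing in $r$. The single-variable function $\xi_\alpha$ is defined by $V_\phi^\alpha(r)=\xi_\alpha(V_\phi(r))$ for all $r\in[r_0,\bar r)$. *)

(* Defs.v *)
From HB Require Import structures.
From mathcomp Require Import all_boot all_order all_algebra.
From mathcomp Require Import all_classical all_reals all_analysis.

Set Implicit Arguments.
Unset Strict Implicit.
Unset Printing Implicit Defensive.

Import Order.TTheory GRing.Theory Num.Theory.
Import numFieldNormedType.Exports.

Local Open Scope classical_set_scope.
Local Open Scope ring_scope.

(* [x ord0 i] is the [i]-th coordinate of [x : 'rV[R]_m]; the library norm of
   ['rV[R]_m] is the sup norm, hence a separate Euclidean norm. *)
Definition dotp (R : realType) (m : nat) (x y : 'rV[R]_m) : R :=
  \sum_(i < m) x ord0 i * y ord0 i.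

Definition enorm (R : realType) (m : nat) (x : 'rV[R]_m) : R :=
  Num.sqrt (dotp x x).

(* S^n as the unit sphere of R^(n+1) *)
Definition sphere (R : realType) (n : nat) : set 'rV[R]_n.+1 :=
  [set x | enorm x = 1].
Arguments sphere : clear implicits.

Definition iter_partial (R : realType) (m : nat) (s : seq 'I_m)
    (f : 'rV[R]_m -> R) : 'rV[R]_m -> R :=
  foldr (fun i g x => 'D_(delta_mx ord0 i) g x) f s.

Definition smooth_on (R : realType) (m : nat) (U : set 'rV[R]_m)
    (f : 'rV[R]_m -> R) : Prop :=
  forall (s : seq 'I_m) (x : 'rV[R]_m), U x ->
    {for x, continuous (iter_partial s f)} /\
    forall i : 'I_m, derivable (iter_partial s f) x (delta_mx ord0 i).

(* A function on the submanifold S^n of R^(n+1) is smooth when it is the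
   restriction of a smooth function on an open neighbourhood of S^n; the values
   of [f] outside [sphere R n] are irrelevant. *)
Definition smooth_on_sphere (R : realType) (n : nat) (f : 'rV[R]_n.+1 -> R) :
    Prop :=
  exists (U : set 'rV[R]_n.+1) (F : 'rV[R]_n.+1 -> R),
    [/\ open U, sphere R n `<=` U, smooth_on U F &
        {in sphere R n, f =1 F}].

Definition hitv (R : realType) (r0 : R) (rbar : \bar R) : set R :=
  [set r | r0 <= r /\ (r%:E < rbar)%E].

(* As usual for a manifold with boundary, smoothness on [r0, rbar) up to the
   endpoint r0 means smoothness on an open neighbourhood of [r0, rbar); [phi]
   stands for such an extension and only its values on [r0, rbar) matter. *)
Definition smooth_on_hitv (R : realType) (r0 : R) (rbar : \bar R)
    (phi : R -> R) : Prop :=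
  exists U : set R,
    [/\ open U, hitv r0 rbar `<=` U &
        forall (k : nat) (r : R), U r -> derivable (phi^`(k))%classic r 1].

Section measurable_rV.
Variables (R : realType) (m : nat).

Let coord : 'I_m -> 'rV[R]_m -> measurableTypeR R := fun i x => x ord0 i.

Let rV_set0 : g_sigma_preimage coord set0.
Proof. exact: sigma_algebra0. Qed.

Let rV_setC A : g_sigma_preimage coord A -> g_sigma_preimage coord (~` A).
Proof. exact: sigma_algebraC. Qed.

Let rV_bigcup (F : (set 'rV[R]_m)^nat) :
  (forall i, g_sigma_preimage coord (F i)) ->
  g_sigma_preimage coord (\bigcup_i (F i)).
Proof. exact: sigma_algebra_bigcup. Qed.

(* The sigma-algebra generated by the coordinates, i.e. the Borel sets of R^m,
   as the library does for [m.-tuple T]. *)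
HB.instance Definition _ := @isMeasurable.Build default_measure_display
  'rV[R]_m (g_sigma_preimage coord) rV_set0 rV_setC rV_bigcup.

End measurable_rV.

Definition rV_cons (R : realType) (m : nat) (p : R * 'rV[R]_m) : 'rV[R]_m.+1 :=
  row_mx (p.1%:M : 'rV[R]_1) p.2.

Fixpoint lebesgue_rV (R : realType) (m : nat) : set 'rV[R]_m -> \bar R :=
  match m with
  | 0 => dirac (0 : 'rV[R]_0)
  | m'.+1 => pushforward (lebesgue_measure \x @lebesgue_rV R m')%E
                         (@rV_cons R m')
  end.

(* sigma(A) = (n+1) |{x : 0 < |x| <= 1, x/|x| in A}|: the (n+1)-dimensional
   volume of the solid cone over A with apex 0 is 1/(n+1) times the area of A.
   [sphere_measure] is a measure on R^(n+1) carried by [sphere R n]. *)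
Definition sphere_measure (R : realType) (n : nat) (A : set 'rV[R]_n.+1) :
    \bar R :=
  (n.+1%:R%:E *
   lebesgue_rV [set x : 'rV[R]_n.+1 | [/\ 0 < enorm x, enorm x <= 1 &
                                          A ((enorm x)^-1 *: x)]%R])%E.

(* A point of N = [r0, rbar) x S^n is a pair (r, theta) : R * 'rV[R]_n.+1.
   Matrix of dr^2 + phi(r)^2 sigma at (r, theta) in a frame
   (d/dr, e_1, ..., e_n) with e_1, ..., e_n orthonormal in T_theta S^n for
   sigma. *)
Definition warped_metric (R : realType) (n : nat) (phi : R -> R) (r : R) :
    'M[R]_(1 + n) :=
  block_mx 1%:M 0 0 (phi r ^+ 2)%:M.
Arguments warped_metric {R} n phi r.

(* dv = vol_density dr dsigma *)
Definition vol_density (R : realType) (n : nat) (phi : R -> R) (r : R) : R :=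
  Num.sqrt (\det (warped_metric n phi r)).
Arguments vol_density {R} n phi r.

Definition weighted_vol (R : realType) (n : nat) (phi : R -> R) (alpha : R)
    (Omega : set (R * 'rV[R]_n.+1)) : \bar R :=
  (\int[lebesgue_measure \x @sphere_measure R n]_(p in Omega)
     (((phi^`())%classic p.1 `^ alpha) * vol_density n phi p.1)%:E)%E.

(* closed region between S(r0) and the graph of [rho] over S^n *)
Definition graph_domain (R : realType) (n : nat) (r0 : R)
    (rho : 'rV[R]_n.+1 -> R) : set (R * 'rV[R]_n.+1) :=
  [set p | sphere R n p.2 /\ r0 <= p.1 <= rho p.2].

Definition rball (R : realType) (n : nat) (r0 r : R) :
    set (R * 'rV[R]_n.+1) :=
  [set p | sphere R n p.2 /\ r0 <= p.1 <= r].
Arguments rball {R} n r0 r.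

Definition graphical (R : realType) (n : nat) (r0 : R) (rbar : \bar R)
    (rho : 'rV[R]_n.+1 -> R) : Prop :=
  [/\ smooth_on_sphere rho,
      forall theta, sphere R n theta -> 0 < rho theta &
      forall theta, sphere R n theta -> hitv r0 rbar (rho theta)].

(* V_phi is strictly increasing in r, so this determines xi on the values of
   V_phi. *)
Definition is_xi (R : realType) (n : nat) (phi : R -> R) (r0 : R)
    (rbar : \bar R) (alpha : R) (xi : \bar R -> \bar R) : Prop :=
  forall r, hitv r0 rbar r ->
    weighted_vol phi alpha (rball n r0 r) =
    xi (weighted_vol phi 1 (rball n r0 r)).
Arguments is_xi {R} n phi r0 rbar alpha xi.

(* Main.v *)
From HB Require Import structures.
Require Import Defs.
From mathcomp Require Import all_boot all_order all_algebra.
From mathcomp Require Import all_classical all_reals all_analysis.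
From mathcomp Require Import measurable_realfun.
From mathcomp Require Import lra.
Import Order.TTheory GRing.Theory Num.Theory.
Import numFieldNormedType.Exports.
Local Open Scope classical_set_scope.
Local Open Scope ring_scope.

(** The statement is an instance of the bathtub principle. Up to the factor
    [phi ^ n], the weighted volumes are integrals over [Omega] of
    [f = phi' phi ^ n] (exponent 1) and of [g = phi' ^ (alpha - 1) f] (exponent
    [alpha]), both functions of the radius alone.

    The volume [V(r)] of [B(r)] for the density [f] is Lipschitz in [r], and the
    compactness of the sphere puts [Omega] inside some [B(M)], so the
    intermediate value theorem yields a radius [r] for which [B(r)] and [Omega]
    have the same [f]-volume ([slab_volume_attained]). By the definition of
    [xi], the number [xi (V Omega)] is then the [g]-volume of [B(r)], and the
    two domains [Omega] and [B(r)] have to be compared.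

    If [phi'' (alpha - 1) < 0], the ratio [w = g / f = phi' ^ (alpha - 1)] is
    strictly decreasing in the radius: it is smaller than [w r] on
    [Omega \ B(r)], which lies beyond radius [r], and at least [w r] on
    [B(r) \ Omega], which lies below. Exchanging one of these differences for
    the other, which has the same [f]-volume, cannot decrease the
    [g]-volume ([bathtub_principle], [slab_weighted_volume_le]). In the opposite
    case the same argument applies to [- g].

    In the case of equality both differences are null sets. Since [rho] is
    continuous and nonempty relatively open subsets of the sphere have positive
    area ([sphere_measure_open_gt0]), this forces [rho = r] on the whole sphere
    ([graph_function_eq]).

    Most of the remaining work is to see that the set functions [lebesgue_rV]
    and [sphere_measure] coincide with genuine measures, the first
    sigma-finite and the second finite, so that integration theory applies. *)

Set Implicit Arguments.
Unset Strict Implicit.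
Unset Printing Implicit Defensive.

(** * Finite and sigma-finite measures *)

(** Turns a property of a measure into the bundled structure on which product
    measures are defined; the underlying set function is unchanged. *)
Lemma exists_sigma_finite_measure d (T : measurableType d) (R : realType)
    (mu : {measure set T -> \bar R}) :
  sigma_finite setT mu ->
  exists nu : {sigma_finite_measure set T -> \bar R},
    (nu : set T -> \bar R) = mu.
Proof.
move=> h.
pose H1 := isSFinite.Build _ _ _ (mu : set T -> \bar R) (sfinite_measure_sigma_finite h).
pose H2 := isSigmaFinite.Build _ _ _ (mu : set T -> \bar R) h.
pose nu := HB.pack_for (SigmaFiniteMeasure.type T R) (Measure.sort mu) H1 H2.
by exists nu.
Qed.

Lemma exists_finite_measure d (T : measurableType d) (R : realType)
    (mu : {measure set T -> \bar R}) :
  fin_num_fun mu ->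
  exists nu : {finite_measure set T -> \bar R}, (nu : set T -> \bar R) = mu.
Proof.
move=> h.
have h0 : sigma_finite setT mu by apply: fin_num_fun_sigma_finite; rewrite ?measure0.
pose H1 := isFinite.Build _ _ _ (mu : set T -> \bar R) h.
pose H2 := isSFinite.Build _ _ _ (mu : set T -> \bar R) (sfinite_measure_sigma_finite h0).
pose H3 := isSigmaFinite.Build _ _ _ (mu : set T -> \bar R) h0.
pose nu := HB.pack_for (FiniteMeasure.type T R) (Measure.sort mu) H1 H2 H3.
by exists nu.
Qed.

(** * Lebesgue measure on row vectors *)

Section borel_rV.
Context (R : realType).

Lemma measurable_coord m (i : 'I_m) :
  measurable_fun setT (fun x : 'rV[R]_m => (x ord0 i : measurableTypeR R)).
Proof.
move=> _ Y mY; rewrite setTI; apply: sub_sigma_algebra => /=.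
rewrite -bigcup_seq/=; exists i => /=; first by rewrite mem_index_enum.
by exists Y => //; rewrite setTI.
Qed.

(** Enough to check coordinates, as they generate the sigma-algebra. *)
Lemma measurable_fun_rV d (T : measurableType d) m (f : T -> 'rV[R]_m) :
  (forall i, measurable_fun setT (fun t => (f t ord0 i : measurableTypeR R))) ->
  measurable_fun setT f.
Proof.
move=> mf; suff : @measurable _ 'rV[R]_m `<=` [set A | measurable (f @^-1` A)].
  by move=> h _ A mA; rewrite setTI; exact: h.
apply: smallest_sub.
  split => /=; first by rewrite preimage_set0.
    by move=> A mA; rewrite setTD preimage_setC; exact: measurableC.
  by move=> F mF; rewrite preimage_bigcup; exact: bigcup_measurable.
rewrite -bigcup_seq => A [i _ [B mB <-]] /=.
by rewrite setTI -comp_preimage -[X in measurable X]setTI; exact: mf.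
Qed.

Lemma rV_cons0 m (p : R * 'rV[R]_m) : rV_cons p ord0 ord0 = p.1.
Proof.
rewrite (_ : ord0 = lshift m (ord0 : 'I_1)); last exact/val_inj.
by rewrite [LHS](@row_mxEl R 1 1 m) mxE eqxx mulr1n.
Qed.

Lemma rV_consS m (p : R * 'rV[R]_m) (j : 'I_m) :
  rV_cons p ord0 (lift ord0 j) = p.2 ord0 j.
Proof.
rewrite (_ : lift ord0 j = rshift 1 j); last exact/val_inj.
exact: (@row_mxEr R 1 1 m).
Qed.

Lemma measurable_rV_cons m :
  measurable_fun setT (@rV_cons R m : measurableTypeR R * 'rV[R]_m -> _).
Proof.
apply: measurable_fun_rV => i.
have [j ->|->] := unliftP ord0 i; last first.
  rewrite (_ : (fun _ => _) = fst); first exact: measurable_fst.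
  by apply/funext => t; exact: rV_cons0.
rewrite (_ : (fun _ => _) = (fun x : 'rV[R]_m => x ord0 j : measurableTypeR R) \o snd).
  by apply: (@measurableT_comp _ _ _ _ _ _
    (fun x : 'rV[R]_m => x ord0 j : measurableTypeR R));
    [exact: measurable_coord|exact: measurable_snd].
by apply/funext => t; exact: rV_consS.
Qed.

(** Unlike [ball x e], which is empty when [e <= 0], a cube of dimension 0 is
    always the whole space; this makes the measurability of cubes unconditional. *)
Definition cube m (x : 'rV[R]_m) (e : R) : set 'rV[R]_m :=
  [set y | forall i, `|x ord0 i - y ord0 i| < e].

Lemma measurable_cube m (x : 'rV[R]_m) e : measurable (cube x e).
Proof.
rewrite (_ : cube x e = \bigcap_(i in [set: 'I_m])
    ((fun y : 'rV[R]_m => y ord0 i : measurableTypeR R) @^-1` (ball (x ord0 i) e))).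
  apply: fin_bigcap_measurable => // i _; rewrite -[X in measurable X]setTI.
  by apply: measurable_coord => //; rewrite ball_itv; exact: measurable_itv.
by apply/seteqP; split=> y /= h => [i _|i]; exact: h.
Qed.

(** That the recursive step yields a measure depends on the sigma-finiteness of
    the measure in dimension [m], and sigma-finiteness is read off from the
    volume of cubes, so the two facts have to be proved by a single induction.
    The equality is one of set functions, on nonmeasurable sets as well. *)
Lemma lebesgue_rV_sigma_finite m :
  exists mu : {sigma_finite_measure set 'rV[R]_m -> \bar R},
  @lebesgue_rV R m = mu /\
  forall x e, 0 < e -> mu (cube x e) = ((e *+ 2) ^+ m)%:E.
Proof.
elim: m => [|m [mu [muE mucube]]].
  exists (dirac (0 : 'rV[R]_0)); split => // x e e0; rewrite expr0 /= diracE mem_set//.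
  by move=> [].
pose nu : {measure set 'rV[R]_m.+1 -> \bar R} :=
  measure_function_pushforward__canonical__measure_function_Measure
    (lebesgue_measure \x mu)%E (@measurable_rV_cons m).
have nucube x e : 0 < e -> nu (cube x e) = ((e *+ 2) ^+ m.+1)%:E.
  move=> e0.
  pose x' : 'rV[R]_m := \row_j x ord0 (lift ord0 j).
  rewrite /= /pushforward.
  rewrite (_ : _ @^-1` _ =
      (ball (x ord0 ord0) e : set (measurableTypeR R)) `*` cube x' e).
    rewrite product_measure1E//; last exact: measurable_cube.
      by rewrite [X in (X * _)%E](lebesgue_measure_ball _ (ltW e0)) mucube// exprS -EFinM.
    by rewrite ball_itv; exact: measurable_itv.
  apply/seteqP; split => [[r y]|[r y]] /=.
    move=> h; split; first by have := h ord0; rewrite rV_cons0.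
    by move=> i; have := h (lift ord0 i); rewrite rV_consS mxE.
  move=> [h1 h2] i; have [j ->|->] := unliftP ord0 i; last first.
    by rewrite rV_cons0.
  by rewrite rV_consS; have := h2 j; rewrite mxE.
have : sigma_finite setT nu.
  exists (fun k => cube 0 k.+1%:R) => [|k]; last first.
    by split; [exact: measurable_cube|rewrite nucube// ltry].
  apply/seteqP; split => // x _.
  pose M := \sum_i `|x ord0 i|.
  exists (Num.trunc M) => // i; rewrite mxE sub0r normrN.
  apply: le_lt_trans (truncnS_gt M).
  by rewrite /M (bigD1 i)//= lerDl sumr_ge0.
move=> /exists_sigma_finite_measure[nu2 nu2E].
by exists nu2; split; [rewrite /= muE nu2E|move=> x e e0; rewrite nu2E; exact: nucube].
Qed.

Lemma cubeP m (x : 'rV[R]_m) e : 0 < e -> cube x e = ball x e.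
Proof.
move=> e0; apply/seteqP; split=> y.
  by move=> h; split=> // i j; rewrite (ord1 i); exact: h.
by move=> [_ h] i; exact: h.
Qed.

(** An open set is the countable union of the cubes with rational centre and
    radius [1 / (k + 1)] that it contains. *)
Lemma open_measurable_rV m (U : set 'rV[R]_m) : open U -> measurable U.
Proof.
move=> oU.
pose Q (p : 'rV[rat]_m * nat) : set 'rV[R]_m := cube (map_mx ratr p.1) p.2.+1%:R^-1.
rewrite (_ : U = \bigcup_(p : 'rV[rat]_m * nat)
    (if pselect (Q p `<=` U) then Q p else set0)).
  apply: countable_bigcupT_measurable => [|p]; first exact: countableP.
  by case: pselect => h; [exact: measurable_cube|exact: measurable0].
apply/seteqP; split => [x Ux|x [p _]]; last by case: pselect => // h /h.
have [e /= e0 xeU] : exists2 e, 0 < e & ball x e `<=` U.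
  by have /nbhs_ballP[e /= e0 h] := open_nbhs_nbhs (conj oU Ux); exists e.
have [k ke] : exists k, k.+1%:R^-1 < e / 2.
  exists (Num.trunc (e / 2)^-1).
  by rewrite invf_plt ?posrE ?divr_gt0// truncnS_gt.
have /choice[q qE] : forall i, exists q : rat, `|ratr q - x ord0 i| < k.+1%:R^-1 :> R.
  move=> i; have [|q] := @rat_in_itvoo R (x ord0 i - k.+1%:R^-1) (x ord0 i + k.+1%:R^-1).
    by rewrite ltrD2l gtrN.
  by rewrite in_itv/= => h; exists q; rewrite ltr_distl.
exists (\row_i q i, k) => //.
case: pselect => [?|h] /=; first by move=> i; rewrite !mxE.
exfalso; apply: h => y yQ; apply: xeU; rewrite -cubeP// => i.
have := yQ i; rewrite /= !mxE => yqi.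
rewrite (le_lt_trans (ler_distD (ratr (q i)) _ _))// [ltRHS]splitr ltrD//.
  by rewrite distrC (lt_trans (qE i)).
exact: lt_trans yqi ke.
Qed.

Lemma open_continuous_measurable_fun_rV m (U : set 'rV[R]_m) (f : 'rV[R]_m -> R) :
  open U -> (forall x, U x -> {for x, continuous f}) ->
  measurable_fun U (f : _ -> measurableTypeR R).
Proof.
move=> oU cf; apply: (measurability _ (measurable_realfun.RGenOpens.measurableE R)).
move=> _ [_ [a [b ->] <-]]; apply: open_measurable_rV.
rewrite openE => x [Ux fx]; rewrite /interior /=.
have V1 : nbhs x U by exact: open_nbhs_nbhs.
have V2 : nbhs x (f @^-1` `]a, b[%classic).
  by apply: (cf _ Ux); apply: open_nbhs_nbhs; split => //; exact: interval_open.
exact: filterI.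
Qed.

(** * The Euclidean norm and the unit sphere *)

Lemma continuous_enorm m : continuous (@enorm R m).
Proof.
move=> x; apply: (@continuous_comp _ _ _ (fun x : 'rV[R]_m => dotp x x) Num.sqrt).
  rewrite /dotp; apply: (continuous_big (op := +%R)) => [|i _].
    exact: add_continuous.
  move=> y; have h : {for y, continuous (fun x : 'rV[R]_m => x ord0 i)}.
    exact: coord_continuous.
  exact: (continuousM h h).
exact: sqrt_continuous.
Qed.

Lemma enorm_ge0 m (x : 'rV[R]_m) : 0 <= enorm x.
Proof. exact: sqrtr_ge0. Qed.

Lemma enormZ m (a : R) (x : 'rV[R]_m) : enorm (a *: x) = `|a| * enorm x.
Proof.
rewrite /enorm (_ : dotp _ _ = a ^+ 2 * dotp x x).
  by rewrite sqrtrM ?sqr_ge0// sqrtr_sqr.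
by rewrite /dotp mulr_sumr; apply: eq_bigr => i _; rewrite mxE mulrACA expr2.
Qed.

Lemma coord_le_enorm m (x : 'rV[R]_m) i : `|x ord0 i| <= enorm x.
Proof.
rewrite -sqrtr_sqr ler_wsqrtr// /dotp (bigD1 i)//= expr2 lerDl.
by apply: sumr_ge0 => j _; rewrite -expr2 sqr_ge0.
Qed.

Lemma measurable_enorm m : measurable_fun setT (@enorm R m : _ -> measurableTypeR R).
Proof.
apply: open_continuous_measurable_fun_rV => [|x _]; first exact: openT.
exact: continuous_enorm.
Qed.

Lemma measurable_sphere n : measurable (sphere R n).
Proof.
rewrite (_ : sphere R n = (@enorm R n.+1 : _ -> measurableTypeR R) @^-1` [set 1]) //.
by rewrite -[X in measurable X]setTI; apply: measurable_enorm => //; exact: measurable_set1.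
Qed.

Lemma compact_sphere n : compact (sphere R n).
Proof.
apply: bounded_closed_compact.
  exists 1; split => // M M1 x xS /=.
  rewrite [leLHS]/Num.norm /= mx_normrE; apply/bigmax_leP; split.
    exact: le_trans (ltW M1).
  move=> [i j] _ /=; rewrite (ord1 i).
  by rewrite (le_trans (coord_le_enorm _ _))// xS ltW.
rewrite (_ : sphere R n = @enorm R n.+1 @^-1` [set 1]) //.
by apply: closed_comp => [x _|]; [exact: continuous_enorm|exact: closed_eq].
Qed.

Lemma sphere_nonempty n : sphere R n !=set0.
Proof.
exists (delta_mx ord0 ord0); rewrite /sphere/= /enorm /dotp (bigD1 ord0)//= big1.
  by rewrite mxE !eqxx mulr1 addr0 sqrtr1.
by move=> i /negbTE i0; rewrite mxE i0 andbF mulr0.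
Qed.

End borel_rV.

(** * The area measure of the sphere *)

Section sphere_measure_theory.
Context (R : realType) (n : nat).

Let N (x : 'rV[R]_n.+1) := (enorm x)^-1 *: x.
Let D : set 'rV[R]_n.+1 := [set x | 0 < enorm x <= 1].

Let measurable_N : measurable_fun setT N.
Proof.
apply: measurable_fun_rV => i.
(* [powR] is measurable on the whole line and agrees with the inverse on
   nonnegative reals, including at 0. *)
rewrite (_ : (fun _ => _) = (fun x => enorm x `^ (-1) * x ord0 i)); last first.
  by apply/funext => x; rewrite /N mxE powR_inv1// enorm_ge0.
apply: measurable_funM; last exact: measurable_coord.
apply: (@measurableT_comp _ _ _ _ _ _
  (fun r : measurableTypeR R => r `^ (-1) : measurableTypeR R)).
  exact: measurable_powR.
exact: measurable_enorm.
Qed.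

Let measurable_D : measurable D.
Proof.
rewrite (_ : D = (@enorm R n.+1 : _ -> measurableTypeR R) @^-1` `]0, 1]%classic).
  by rewrite -[X in measurable X]setTI; apply: measurable_enorm => //; exact: measurable_itv.
by apply/seteqP; split => x; rewrite /D /= in_itv.
Qed.

(** [sphere_measure] is the image of Lebesgue measure on the punctured unit ball
    [D], times [n + 1], under the radial projection [N]; it is finite because
    [D] fits into a cube. *)
Lemma sphere_measure_finite :
  exists mu : {finite_measure set 'rV[R]_n.+1 -> \bar R}, @sphere_measure R n = mu.
Proof.
have [leb [lebE lebcube]] := @lebesgue_rV_sigma_finite R n.+1.
pose nu : {measure set 'rV[R]_n.+1 -> \bar R} :=
  measure_function_pushforward__canonical__measure_function_Measure
    (mrestr leb measurable_D) measurable_N.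
have n0 : 0 <= n.+1%:R :> R by [].
pose sig := mscale (NngNum n0) nu.
have sigE : @sphere_measure R n = sig.
  apply/funext => A; rewrite /sphere_measure lebE /sig /mscale /=.
  congr (_ * leb _)%E; apply/seteqP; split => x /=.
    by move=> [x0 x1 Ax]; split => //; rewrite /D/= x0.
  by move=> [Ax /andP[x0 x1]].
have fin : fin_num_fun sig.
  move=> A mA; rewrite ge0_fin_numE//.
  apply: (@le_lt_trans _ _ (sig setT)); first by apply: le_measure; rewrite ?inE.
  rewrite /sig /mscale /= lte_mul_pinfty ?lee_fin//.
  rewrite /pushforward preimage_setT /mrestr setTI.
  apply: (@le_lt_trans _ _ (leb (cube 0 2))); last by rewrite lebcube// ltry.
  apply: le_measure; rewrite ?inE//; first exact: measurable_cube.
  move=> x /andP[_ x1] i; rewrite mxE sub0r normrN.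
  by rewrite (le_lt_trans (coord_le_enorm _ _))// (le_lt_trans x1)// ltrDl.
by have [mu muE] := exists_finite_measure fin; exists mu; rewrite sigE muE.
Qed.

(** The cone over a neighbourhood of [theta] contains a small cube around
    [theta / 2], which has positive volume. *)
Lemma sphere_measure_open_gt0 (U : set 'rV[R]_n.+1) theta :
  open U -> U theta -> sphere R n theta ->
  (0 < @sphere_measure R n (U `&` sphere R n))%E.
Proof.
move=> oU Ut St.
have [leb [lebE lebcube]] := @lebesgue_rV_sigma_finite R n.+1.
pose x0 := 2^-1 *: theta.
have x0E : enorm x0 = 2^-1 by rewrite enormZ St mulr1 ger0_norm// invr_ge0.
have Nx0 : N x0 = theta by rewrite /N x0E invrK /x0 scalerA mulfV// scale1r.
have cN : {for x0, continuous N}.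
  apply: continuousZ; last exact: cvg_id.
  apply: continuousV; first by rewrite x0E invr_eq0.
  exact: continuous_enorm.
have : nbhs x0 [set x | 0 < enorm x < 1 /\ U (N x)].
  apply: filterI; last by apply: cN; rewrite Nx0; exact: open_nbhs_nbhs.
  suff h : nbhs (enorm x0) [set r : R | 0 < r < 1].
    exact: (@continuous_enorm R n.+1 x0 _ h).
  have := @near_in_itvoo R 0 1 (enorm x0).
  rewrite x0E in_itv/= invr_gt0 ltr0n/= invf_lt1 ?ltr0n// ltr1n => /(_ isT).
  by apply: filterS => y; rewrite in_itv.
move=> /nbhs_ballP[e /= e0 eW].
rewrite /sphere_measure mule_gt0 ?lte_fin// lebE.
apply: (@lt_le_trans _ _ (leb (cube x0 e))).
  by rewrite lebcube// lte_fin exprn_gt0// mulrn_wgt0.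
apply: le_measure; rewrite ?inE; first exact: measurable_cube.
  rewrite (_ : [set _ | _] = D `&` N @^-1` (U `&` sphere R n)).
    apply: measurableI => //; rewrite -[X in measurable X]setTI.
    apply: measurable_N => //; apply: measurableI; last exact: measurable_sphere.
    exact: open_measurable_rV.
  apply/seteqP; split => x /=; first by move=> [? ? ?]; split => //; apply/andP.
  by move=> [/andP[]].
rewrite cubeP// => x /eW [/andP[h1 h2] Ux]; split => //=; first exact: ltW.
split => //; rewrite /sphere/= enormZ gtr0_norm ?invr_gt0// mulVf// gt_eqF//.
Qed.

End sphere_measure_theory.

(** * The bathtub principle *)

Section bathtub.
Context d (T : measurableType d) (R : realType) (mu : {measure set T -> \bar R}).

(** Stated with a subset [E] of [D] because [h] may vanish on the rest of [D]. *)
Lemma Rintegral_eq0_null (D E : set T) (h : T -> R) :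
  measurable D -> mu.-integrable D (EFin \o h) -> (forall x, D x -> 0 <= h x) ->
  \int[mu]_(x in D) h x = 0 ->
  measurable E -> E `<=` D -> (forall x, E x -> h x != 0) -> mu E = 0.
Proof.
move=> mD ih h0 hint mE ED hE; apply/negligibleP => //.
have /ae_eq_integral_abs : measurable_fun D (EFin \o h) by case/integrableP : ih.
move=> /(_ mu mD)[+ _] => /(_ _)[].
  rewrite (eq_integral (EFin \o h)).
    by rewrite -(fineK (integrable_fin_num mD ih)); congr EFin.
  by move=> x; rewrite inE => /h0 hx; rewrite /= ger0_norm.
move=> X [mX X0 DX]; exists X; split => // x Ex; apply: DX => /=.
by move=> /(_ (ED _ Ex))[] hx0; have := hE _ Ex; rewrite hx0 eqxx.
Qed.

Lemma Rintegral_setID (A B : set T) (h : T -> R) :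
  measurable A -> measurable B -> mu.-integrable A (EFin \o h) ->
  \int[mu]_(x in A) h x =
  \int[mu]_(x in A `&` B) h x + \int[mu]_(x in A `\` B) h x.
Proof.
move=> mA mB ih; rewrite -[in LHS](setUIDK A B) Rintegral_setU//.
- exact: measurableI.
- exact: measurableD.
- by rewrite setUIDK.
- by apply/disj_setPS => x [[_ ?] []].
Qed.

Variables (A B : set T) (f g : T -> R) (c : R).
Hypotheses (mA : measurable A) (mB : measurable B).
Hypotheses (fA : mu.-integrable A (EFin \o f)) (fB : mu.-integrable B (EFin \o f)).
Hypotheses (gA : mu.-integrable A (EFin \o g)) (gB : mu.-integrable B (EFin \o g)).
Hypothesis fAB : \int[mu]_(x in A) f x = \int[mu]_(x in B) f x.
Hypothesis gAB : forall x, (A `\` B) x -> g x <= c * f x.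
Hypothesis gBA : forall x, (B `\` A) x -> c * f x <= g x.

(** With [h = g - c f] one has [h <= 0] on [A \ B] and [h >= 0] on [B \ A],
    hence the integral of [h] over [A] is at most the one over [B]; the two
    integrals of [c f] agree. Equality makes the integrals of [h] over [A \ B]
    and over [B \ A] vanish, so the part of these sets where [h] does not
    vanish is null. *)
Lemma bathtub_principle :
  \int[mu]_(x in A) g x <= \int[mu]_(x in B) g x /\
  (\int[mu]_(x in A) g x = \int[mu]_(x in B) g x ->
   forall E, measurable E -> E `<=` A `\` B \/ E `<=` B `\` A ->
   (forall x, E x -> g x != c * f x) -> mu E = 0).
Proof.
pose h x := g x - c * f x.
have ih D : measurable D -> mu.-integrable D (EFin \o f) -> mu.-integrable D (EFin \o g) ->
    mu.-integrable D (EFin \o h) /\ \int[mu]_(x in D) h x =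
      \int[mu]_(x in D) g x - c * \int[mu]_(x in D) f x.
  move=> mD fD gD.
  have cfD : mu.-integrable D (EFin \o (fun x => c * f x)).
    exact: (integrableZl mD c fD).
  split; first exact: (integrableB mD gD cfD).
  by rewrite RintegralB// RintegralZl.
have [hA hAE] := ih _ mA fA gA.
have [hB hBE] := ih _ mB fB gB.
have mAB : measurable (A `\` B) by exact: measurableD.
have mBA : measurable (B `\` A) by exact: measurableD.
have iAB : mu.-integrable (A `\` B) (EFin \o h).
  by apply: integrableS hA => //; exact: subDsetl.
have iBA : mu.-integrable (B `\` A) (EFin \o h).
  by apply: integrableS hB => //; exact: subDsetl.
have iNAB : mu.-integrable (A `\` B) (EFin \o (fun x => - h x)) by exact: (integrableN iAB).
have NAB0 : 0 <= \int[mu]_(x in A `\` B) - h x.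
  by apply: Rintegral_ge0 => x /gAB; rewrite /h oppr_ge0 subr_le0.
have NABE : \int[mu]_(x in A `\` B) - h x = - \int[mu]_(x in A `\` B) h x.
  under eq_Rintegral do rewrite -mulN1r.
  by rewrite RintegralZl// mulN1r.
have BA0 : 0 <= \int[mu]_(x in B `\` A) h x.
  by apply: Rintegral_ge0 => x /gBA; rewrite /h subr_ge0.
have hAS := Rintegral_setID mA mB hA.
have hBS := Rintegral_setID mB mA hB.
rewrite setIC in hBS.
rewrite fAB in hAE.
split; first lra.
move=> gE E mE [EAB|EBA] hE.
  apply: (Rintegral_eq0_null mAB iNAB _ _ mE EAB); last 2 first.
  - lra.
  - by move=> x /hE; rewrite oppr_eq0 subr_eq0.
  - by move=> x /gAB; rewrite oppr_ge0 subr_le0.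
apply: (Rintegral_eq0_null mBA iBA _ _ mE EBA); last 2 first.
- lra.
- by move=> x /hE; rewrite subr_eq0.
- by move=> x /gBA; rewrite subr_ge0.
Qed.

End bathtub.

(** * Slabs over a finite measure space *)

Section slab.
Context d (T : measurableType d) (R : realType).
Context (sig : {finite_measure set T -> \bar R}) (S : set T) (mS : measurable S).
Context (r0 M : R) (r0M : r0 <= M).

Let mu := (@lebesgue_measure R \x sig)%E.

(** The closed region between height [r0] and the graph of [u] over [S]. It is
    convertible to [graph_domain] when [S] is the sphere, and to [rball] when
    moreover [u] is constant. *)
Definition slab (u : T -> R) : set (measurableTypeR R * T) :=
  [set p | S p.2 /\ r0 <= p.1 <= u p.2].

Lemma measurable_slab (u : T -> R) :
  measurable_fun S (u : T -> measurableTypeR R) -> measurable (slab u).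
Proof.
move=> mu_.
pose D : set (measurableTypeR R * T) := (`[r0, +oo[%classic : set (measurableTypeR R)) `*` S.
have mD : measurable D by apply: measurableX => //; exact: measurable_itv.
have mf : measurable_fun D (fun p => u p.2 - p.1 : measurableTypeR R).
  apply: measurable_funB; last exact: (measurable_funS measurableT).
  apply: (measurable_comp (F := S)) => //.
    by move=> _ [p [_ Sp] <-].
  exact: (measurable_funS measurableT).
rewrite (_ : slab u = D `&`
    (fun p => u p.2 - p.1 : measurableTypeR R) @^-1` `[0, +oo[%classic).
  by apply: mf => //; exact: measurable_itv.
apply/seteqP; split => -[r t]; rewrite /slab /D /= !in_itv/= !andbT subr_ge0.
  by move=> [St /andP[h1 h2]].
by move=> [[h1 St] h2]; split => //; apply/andP.
Qed.

Let box : set (measurableTypeR R * T) := (`[r0, M]%classic : set (measurableTypeR R)) `*` S.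

Let rect_lty a b (E : set T) : measurable E ->
  mu ((`]a, b]%classic : set (measurableTypeR R)) `*` E) =
  (((if a < b then b - a else 0)%:E) * sig E)%E.
Proof.
move=> mE; rewrite /mu product_measure1E//.
congr (_ * _)%E; rewrite [LHS](lebesgue_measure_itv `]a, b]) /= lte_fin.
by case: ifP => // _; rewrite EFinB.
Qed.

Let box_lty E : measurable E -> E `<=` box -> (mu E < +oo)%E.
Proof.
move=> mE Eb; apply: (@le_lt_trans _ _
    (mu ((`]r0 - 1, M]%classic : set (measurableTypeR R)) `*` S))).
  apply: le_measure; rewrite ?inE//.
    by apply: measurableX => //; exact: measurable_itv.
  move=> p /Eb[]; rewrite /= !in_itv/= => /andP[h1 h2] Sp; split => //=.
  by rewrite h2 andbT (lt_le_trans _ h1)// gtrBl.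
rewrite rect_lty// lte_mul_pinfty ?lee_fin//.
  by case: ifPn => // ?; rewrite subr_ge0 ltW.
by rewrite ltey_eq fin_num_measure.
Qed.

Let slab_box u : (forall t, S t -> u t <= M) -> slab u `<=` box.
Proof.
move=> uM p [Sp /andP[h1 h2]]; split => //=.
by rewrite in_itv/= h1 (le_trans h2)// uM.
Qed.

Section integrand.
Variable f : R -> R.
Hypothesis cf : {within `[r0, M], continuous f}.

Lemma bounded_integrand : exists2 C, 0 <= C & forall r, r0 <= r <= M -> `|f r| <= C.
Proof.
have [r1 _ h1] := EVT_max r0M cf; have [r2 _ h2] := EVT_min r0M cf.
exists (Num.max `|f r1| `|f r2|); first by rewrite le_max normr_ge0.
move=> r rM; have {}rM : r \in `[r0, M] by rewrite in_itv.
rewrite le_max; case: (ger0P (f r)) => f0; apply/orP.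
  by left; apply: le_trans (ler_norm _); exact: h1.
by right; rewrite -normrN; apply: le_trans (ler_norm _); rewrite lerN2; exact: h2.
Qed.

Lemma measurable_integrand : measurable_fun box (fun p => f p.1 : measurableTypeR R).
Proof.
apply: (measurable_comp (F := `[r0, M]%classic : set (measurableTypeR R))) => //.
- by move=> _ [p [? _] <-].
- by apply: subspace_continuous_measurable_fun => //; exact: measurable_itv.
- exact: (measurable_funS measurableT).
Qed.

Lemma integrable_integrand E : measurable E -> E `<=` box ->
  mu.-integrable E (EFin \o (fun p => f p.1)).
Proof.
move=> mE Eb; apply: measurable_bounded_integrable => //; first exact: box_lty.
  by apply: measurable_funS measurable_integrand => //;
    apply: measurableX => //; exact: measurable_itv.
have [C C0 fC] := bounded_integrand.
exists C; split => //; first by rewrite realE C0.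
move=> y Cy p /Eb[/= + _]; rewrite in_itv/= => /fC h; exact: le_trans h (ltW Cy).
Qed.

Lemma integrable_slab u : measurable_fun S (u : T -> measurableTypeR R) ->
  (forall t, S t -> u t <= M) -> mu.-integrable (slab u) (EFin \o (fun p => f p.1)).
Proof.
by move=> mu_ uM; apply: integrable_integrand; [exact: measurable_slab|exact: slab_box].
Qed.

Hypothesis f0 : forall r, r0 <= r <= M -> 0 < f r.

Local Notation V u := (\int[mu]_(p in slab u) f p.1).

Let measurable_slab_cst r : measurable (slab (cst r)).
Proof. by apply: measurable_slab; exact: measurable_cst. Qed.

Let f_ge0 (u : T -> R) p : (forall t, S t -> u t <= M) -> slab u p -> 0 <= f p.1.
Proof.
by move=> uM /(slab_box uM)[/= + _]; rewrite in_itv/= => /f0 /ltW.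
Qed.

Let slab_volumeB u v :
  measurable_fun S (u : T -> measurableTypeR R) ->
  measurable_fun S (v : T -> measurableTypeR R) ->
  (forall t, S t -> u t <= v t) -> (forall t, S t -> v t <= M) ->
  V v = V u + \int[mu]_(p in slab v `\` slab u) f p.1.
Proof.
move=> mu_ mv uv vM.
rewrite (Rintegral_setID (measurable_slab mv) (measurable_slab mu_) (integrable_slab mv vM)).
congr (_ + _); congr (Rintegral _ _ _); apply/setIidPr => p [Sp /andP[h1 h2]].
by split => //; rewrite h1 (le_trans h2)// uv.
Qed.

Let slab_volume_le u v :
  measurable_fun S (u : T -> measurableTypeR R) ->
  measurable_fun S (v : T -> measurableTypeR R) ->
  (forall t, S t -> u t <= v t) -> (forall t, S t -> v t <= M) ->
  V u <= V v.
Proof.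
move=> mu_ mv uv vM; rewrite (slab_volumeB mu_ mv uv vM) lerDl.
by apply: Rintegral_ge0 => p [vp _]; exact: f_ge0 vp.
Qed.

(** The slabs of heights [s <= t] differ by the product of [S] with an
    interval of length [t - s], on which [f] is bounded. *)
Lemma slab_volume_lipschitz : exists2 K, 0 <= K &
  forall s t, r0 <= s -> s <= t -> t <= M ->
  V (cst s) <= V (cst t) <= V (cst s) + K * (t - s).
Proof.
have [C C0 fC] := bounded_integrand.
exists (C * fine (sig S)); first by rewrite mulr_ge0// fine_ge0.
move=> s t r0s st tM; rewrite slab_volume_le//=.
rewrite (@slab_volumeB (cst s) (cst t))// lerD2l.
set D := _ `\` _.
have DE : D = (`]s, t]%classic : set (measurableTypeR R)) `*` S.
  apply/seteqP; split => -[r x]; rewrite /D /slab /= in_itv/=.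
    move=> [[Sx /andP[h1 h2]] h3]; rewrite h2 andbT; split => //.
    by rewrite ltNge; apply/negP => rs; apply: h3; rewrite h1 rs.
  move=> [/andP[h1 h2] Sx]; rewrite h2 (le_trans r0s (ltW h1)); split => //.
  by move=> [_]; rewrite leNgt h1.
have mD : measurable D by rewrite DE; apply: measurableX => //; exact: measurable_itv.
have Db : D `<=` box by apply: subset_trans (@slab_box (cst t) _) => // p [].
have Dfin : (mu D < +oo)%E by exact: box_lty.
apply: (@le_trans _ _ (\int[mu]_(p in D) C)).
  apply: le_Rintegral => //; first exact: integrable_integrand.
    apply: measurable_bounded_integrable => //; exact: bounded_cst.
  move=> p /Db[/= + _]; rewrite in_itv/= => /fC; exact: le_trans (ler_norm _).
rewrite Rintegral_cst// DE [X in fine X](rect_lty _ _ mS).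
have [lt_st|] := ltP s t; last first.
  by rewrite mul0e mulr0 => ?; rewrite mulr_ge0 ?subr_ge0// mulr_ge0// fine_ge0.
by rewrite fineM ?fin_num_measure//= (mulrC (t - s)) mulrA.
Qed.

Lemma slab_volume_continuous : {within `[r0, M], continuous (fun r => V (cst r))}.
Proof.
have [K K0 VK] := slab_volume_lipschitz.
have {}VK s t : r0 <= s <= M -> r0 <= t <= M -> `|V (cst s) - V (cst t)| <= K * `|s - t|.
  move=> /andP[s1 s2] /andP[t1 t2]; have [st|/ltW ts] := leP s t.
    have /andP[h1 h2] := VK _ _ s1 st t2.
    rewrite ler0_norm ?subr_le0// [`|s - t|]ler0_norm ?subr_le0//; lra.
  have /andP[h1 h2] := VK _ _ t1 ts s2.
  rewrite ger0_norm ?subr_ge0// [`|s - t|]ger0_norm ?subr_ge0//; lra.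
apply/subspace_continuousP => r /=; rewrite in_itv/= => rM.
apply/cvgrPdist_lt => e e0; rewrite /within /=.
have K1 : 0 < K + 1 by rewrite ltr_wpDl.
apply/nbhs_ballP; exists (e / (K + 1)) => /=; first exact: divr_gt0.
move=> t; rewrite /ball/= => rt; rewrite in_itv/= => tM.
apply: le_lt_trans (VK _ _ rM tM) _.
move: rt; rewrite ltr_pdivlMr// mulrC; apply: le_lt_trans.
by rewrite ler_wpM2r// lerDl.
Qed.

(** Intermediate value theorem: the volume of the slab of [u] lies between those
    of the slabs of constant heights [r0] and [M], by monotonicity. *)
Lemma slab_volume_attained u : measurable_fun S (u : T -> measurableTypeR R) ->
  (forall t, S t -> r0 <= u t <= M) ->
  exists2 r, r0 <= r <= M & V u = V (cst r).
Proof.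
move=> mu_ uM.
have [|r rM rE] := @IVT _ (fun r => V (cst r)) r0 M (V u) r0M slab_volume_continuous.
  rewrite ge_min le_max; apply/andP; split; apply/orP; [left|right].
    by apply: slab_volume_le => // t /uM/andP[].
  by apply: slab_volume_le => // t /uM/andP[].
by exists r => //; rewrite -in_itv.
Qed.

End integrand.

(** The bathtub principle with threshold [w r]. In the case of equality, the set
    where [a < u] has zero measure for every [a > r], because its product with
    the interval of heights between [r] and [a] lies in the difference of the
    two slabs, where [w] differs from [w r]; similarly for the set where [u < a]
    when [a < r]. *)
Lemma slab_weighted_volume_le (f g w : R -> R) (u : T -> R) (r : R) :
  {within `[r0, M], continuous f} -> {within `[r0, M], continuous g} ->
  (forall s, r0 <= s <= M -> 0 < f s) ->
  (forall s, r0 <= s <= M -> g s = w s * f s) ->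
  (forall s t, r0 <= s -> s < t -> t <= M -> w t < w s) ->
  measurable_fun S (u : T -> measurableTypeR R) ->
  (forall t, S t -> r0 <= u t <= M) ->
  r0 <= r <= M ->
  \int[mu]_(p in slab u) f p.1 = \int[mu]_(p in slab (cst r)) f p.1 ->
  \int[mu]_(p in slab u) g p.1 <= \int[mu]_(p in slab (cst r)) g p.1 /\
  (\int[mu]_(p in slab u) g p.1 = \int[mu]_(p in slab (cst r)) g p.1 ->
   (forall a, r < a -> sig (S `&` [set t | a < u t]) = 0) /\
   (forall a, a < r -> sig (S `&` [set t | u t < a]) = 0)).
Proof.
move=> cf cg f0 gE wS mu_ uM /andP[r0r rM] Vur.
have mA := measurable_slab mu_.
have mB : measurable (slab (cst r)) by apply: measurable_slab; exact: measurable_cst.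
have Ab : slab u `<=` box by apply: slab_box => t /uM/andP[].
have Bb : slab (cst r) `<=` box by apply: slab_box.
have boxE p : box p -> r0 <= p.1 <= M by move=> [/= + _]; rewrite in_itv.
have [||le_gg null] := @bathtub_principle _ _ _ mu (slab u) (slab (cst r)) (fun p => f p.1)
  (fun p => g p.1) (w r) mA mB
  (integrable_integrand cf mA Ab) (integrable_integrand cf mB Bb)
  (integrable_integrand cg mA Ab) (integrable_integrand cg mB Bb) Vur.
- move=> p [Ap NBp]; have pM := boxE _ (Ab _ Ap).
  rewrite gE// ler_pM2r ?f0//; apply/ltW/wS => //; last by case/andP: pM.
  rewrite ltNge; apply/negP => pr; apply: NBp; case: Ap => Sp /andP[h _].
  by split => //; rewrite h.
- move=> p [Bp NAp]; have pM := boxE _ (Bb _ Bp).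
  rewrite gE// ler_pM2r ?f0//; case: Bp => Sp /andP[h1 /= h2].
  by move: h2; rewrite le_eqVlt => /predU1P[->//|h2]; apply/ltW/wS.
split => // /null{}null.
have mgt a : measurable (S `&` [set t | a < u t]).
  rewrite (_ : [set t | _] = (u : T -> measurableTypeR R) @^-1` `]a, +oo[%classic).
    by apply: mu_ => //; exact: measurable_itv.
  by apply/seteqP; split => t /=; rewrite in_itv/= andbT.
have mlt a : measurable (S `&` [set t | u t < a]).
  rewrite (_ : [set t | _] = (u : T -> measurableTypeR R) @^-1` `]-oo, a[%classic).
    by apply: mu_ => //; exact: measurable_itv.
  by apply/seteqP; split => t /=; rewrite in_itv.
have rect0 a b E : a < b -> measurable E ->
    mu ((`]a, b]%classic : set (measurableTypeR R)) `*` E) = 0 -> sig E = 0.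
  move=> ab mE; rewrite rect_lty// ab => /eqP; rewrite mule_eq0 eqe subr_eq0 gt_eqF//=.
  by move=> /eqP.
split => a ra.
  apply: (rect0 r a) => //; apply: null.
  - by apply: measurableX => //; exact: measurable_itv.
  - left => p [/=]; rewrite in_itv/= => /andP[h1 h2] [Sp h3]; split.
      by split => //; rewrite (le_trans r0r (ltW h1)) (le_trans h2 (ltW h3)).
    by move=> [_] /=; rewrite (leNgt p.1 r) h1 andbF.
  - move=> p [/=]; rewrite in_itv/= => /andP[h1 h2] [Sp h3].
    have pM : r0 <= p.1 <= M.
      rewrite (le_trans r0r (ltW h1)) (le_trans h2)// (le_trans (ltW h3))//.
      by case/andP: (uM _ Sp).
    have /andP[_ ?] := pM.
    by rewrite gE// (inj_eq (mulIf (lt0r_neq0 (f0 _ pM)))) lt_eqF// wS.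
have [ra0|ar0] := leP a r0.
  rewrite (_ : _ `&` _ = set0) ?measure0//; apply/seteqP; split => // t [St /=].
  by rewrite ltNge (le_trans ra0)//; case/andP: (uM _ St).
(* The rectangle must stop at some [b < r], as [w] takes the threshold value at
   height [r]. *)
pose b := (a + r) / 2.
have ab : a < b by rewrite /b; lra.
have br : b < r by rewrite /b; lra.
apply: (rect0 a b) => //; apply: null.
- by apply: measurableX => //; exact: measurable_itv.
- right => p [/=]; rewrite in_itv/= => /andP[h1 h2] [Sp h3]; split.
    by split => //=; rewrite (le_trans (ltW ar0) (ltW h1)) (le_trans h2 (ltW br)).
  by move=> [_ /andP[_]]; rewrite leNgt (lt_trans h3 h1).
- move=> p [/=]; rewrite in_itv/= => /andP[h1 h2] [Sp h3].
  have pM : r0 <= p.1 <= M.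
    by rewrite (le_trans (ltW ar0) (ltW h1)) (le_trans h2)// (le_trans (ltW br)).
  have /andP[? _] := pM.
  rewrite gE// (inj_eq (mulIf (lt0r_neq0 (f0 _ pM)))) gt_eqF// wS//.
  exact: le_lt_trans br.
Qed.

End slab.

(** Covers both signs of [a]: the power function increases for [a > 0] and
    decreases for [a < 0]. *)
Lemma powR_lt_of_mul (R : realType) (a x y : R) : 0 < x -> 0 < y ->
  a * x < a * y -> x `^ a < y `^ a.
Proof.
move=> x0 y0; have [a0|a0|->] := ltgtP a 0; last by rewrite !mul0r ltxx.
  rewrite ltr_nM2l// => yx; rewrite -(opprK a) !(powRN _ (- a)) ltf_pV2 ?posrE ?powR_gt0//.
  by apply: gt0_ltr_powR; rewrite ?nnegrE ?oppr_gt0// ltW.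
by rewrite ltr_pM2l// => xy; apply: gt0_ltr_powR => //; rewrite nnegrE ltW.
Qed.

Lemma vol_densityE (R : realType) n (phi : R -> R) r :
  vol_density n phi r = `|phi r ^+ n|.
Proof.
rewrite /vol_density /warped_metric det_lblock det1 mul1r det_scalar.
by rewrite exprAC sqrtr_sqr.
Qed.

(** * Densities on the warped product *)

Section warped.
Context (R : realType) (n : nat) (r0 : R) (rbar : \bar R) (phi : R -> R).
Hypothesis phi_smooth : smooth_on_hitv r0 rbar phi.
Hypothesis phi_gt0 : forall r, hitv r0 rbar r -> 0 < phi r.
Hypothesis dphi_gt0 : forall r, hitv r0 rbar r -> 0 < phi^`()%classic r.

Definition weight (a r : R) := phi^`()%classic r `^ a * vol_density n phi r.

Lemma hitv_le r s : r0 <= r -> r <= s -> hitv r0 rbar s -> hitv r0 rbar r.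
Proof. by move=> r0r rs [_ sr]; split => //; rewrite (le_lt_trans _ sr)// lee_fin. Qed.

Lemma derivable_phi k r : hitv r0 rbar r -> derivable (phi^`(k))%classic r 1.
Proof. by have [U [_ HU dphi]] := phi_smooth; move=> /HU; exact: dphi. Qed.

Lemma continuous_phi k r : hitv r0 rbar r -> {for r, continuous (phi^`(k))%classic}.
Proof. by move=> /(@derivable_phi k)/derivable1_diffP/differentiable_continuous. Qed.

Lemma weight_continuous a r : hitv r0 rbar r -> {for r, continuous (weight a)}.
Proof.
move=> hr; have dc := @continuous_phi 1 _ hr; have pc := @continuous_phi 0 _ hr.
apply: (@continuousM _ _ (fun r => phi^`()%classic r `^ a) (vol_density n phi)).
  apply: (@continuous_comp _ _ _ _ (fun x => x `^ a)) => //.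
  apply/differentiable_continuous/derivable1_diffP/derivable_powR.
  by rewrite in_itv/= andbT dphi_gt0.
rewrite (_ : vol_density n phi = (fun x => `|x|) \o (fun x => x ^+ n) \o phi).
  apply: (@continuous_comp _ _ _ phi) => //.
  by apply: continuous_comp; [exact: exprn_continuous|exact: norm_continuous].
by apply/funext => x; rewrite vol_densityE.
Qed.

Lemma weight_gt0 a r : hitv r0 rbar r -> 0 < weight a r.
Proof.
move=> hr; rewrite mulr_gt0 ?powR_gt0 ?dphi_gt0//.
by rewrite vol_densityE normr_gt0 gt_eqF// exprn_gt0// phi_gt0.
Qed.

Lemma weightE a r : hitv r0 rbar r ->
  weight a r = phi^`()%classic r `^ (a - 1) * weight 1 r.
Proof.
move=> hr; rewrite /weight mulrA -powRD ?subrK//.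
by apply/implyP => _; rewrite gt_eqF// dphi_gt0.
Qed.

(** Mean value theorem. With [b = alpha - 1], the hypothesis on the sign of
    [phi'' b] makes [b phi'] monotone without any case distinction on the sign
    of [b]. *)
Lemma dphi_scaled_decreasing (b : R) s t :
  (forall r, hitv r0 rbar r -> phi^`(2)%classic r * b < 0) ->
  r0 <= s -> s < t -> hitv r0 rbar t ->
  b * phi^`()%classic t < b * phi^`()%classic s.
Proof.
move=> hb r0s st ht.
have hst x : s <= x <= t -> hitv r0 rbar x.
  by move=> /andP[h1 h2]; apply: hitv_le ht => //; exact: le_trans h1.
have [x||c cst cE] := @MVT _ (phi^`()%classic) (phi^`(2)%classic) s t st.
- rewrite in_itv/= => /andP[h1 h2]; rewrite (_ : _ x = 'D_1 (phi^`()%classic) x).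
    by apply: derivableP; apply: (@derivable_phi 1); apply: hst; rewrite !ltW.
  by rewrite -derive1E.
- apply: derivable_within_continuous => x; rewrite in_itv/= => xst.
  exact: (@derivable_phi 1) (hst _ xst).
move: cst; rewrite in_itv/= => /andP[h1 h2].
have := hb c (hst c _); rewrite !ltW// => /(_ isT).
rewrite -(subr_lt0 (b * _)) -mulrBr cE mulrA (mulrC b) => h; by rewrite pmulr_llt0 ?subr_gt0.
Qed.

(** * The graph function *)

Section graph_function.
Context (rho : 'rV[R]_n.+1 -> R).
Hypothesis M_graphical : graphical r0 rbar rho.

Lemma graph_function_ext : exists (U : set 'rV[R]_n.+1) (F : 'rV[R]_n.+1 -> R),
  [/\ open U, sphere R n `<=` U, (forall x, U x -> {for x, continuous F}) &
      {in sphere R n, rho =1 F}].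
Proof.
have [[U [F [oU SU smF rF]]] _ _] := M_graphical.
by exists U, F; split => // x /(smF [::])[].
Qed.

Lemma graph_function_max :
  exists2 M, hitv r0 rbar M & forall t, sphere R n t -> r0 <= rho t <= M.
Proof.
have [U [F [oU SU cF rF]]] := graph_function_ext.
have [_ _ rhoh] := M_graphical.
have [t tS tmax] := EVT_max_rV (@sphere_nonempty R n) (@compact_sphere R n)
  (continuous_in_subspaceT (fun x xS => cF x (SU _ (set_mem xS)))).
exists (rho t); first by apply: rhoh; exact: set_mem.
move=> x xS; rewrite (rhoh _ xS).1/= !rF//; last exact/mem_set.
exact/tmax/mem_set.
Qed.

Lemma measurable_graph_function :
  measurable_fun (sphere R n) (rho : 'rV[R]_n.+1 -> measurableTypeR R).
Proof.
have [U [F [oU SU cF rF]]] := graph_function_ext.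
apply: (@eq_measurable_fun _ _ _ _ _ (F : 'rV[R]_n.+1 -> measurableTypeR R)).
  by move=> x xS; rewrite rF.
apply: measurable_funS SU (open_continuous_measurable_fun_rV oU cF).
exact: open_measurable_rV.
Qed.

(** If [rho t > r] for some [t], then [rho > a] on a relatively open subset of
    the sphere, for [a] the midpoint of [r] and [rho t]; such a set has positive
    measure. Symmetrically if [rho t < r]. *)
Lemma graph_function_eq (r : R) :
  (forall a, r < a -> sphere_measure (sphere R n `&` [set t | a < rho t]) = 0%E) ->
  (forall a, a < r -> sphere_measure (sphere R n `&` [set t | rho t < a]) = 0%E) ->
  forall t, sphere R n t -> rho t = r.
Proof.
have [U [F [oU SU cF rF]]] := graph_function_ext.
have key (V : set R) t : open V -> sphere R n t -> V (rho t) ->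
    sphere_measure (sphere R n `&` [set t | V (rho t)]) <> 0%E.
  move=> oV St Vt; apply/eqP; rewrite gt_eqF//.
  have oUV : open (U `&` F @^-1` V).
    rewrite openE => x [Ux Vx]; rewrite /interior; apply: filterI.
      exact: open_nbhs_nbhs.
    by apply: (cF _ Ux); exact: open_nbhs_nbhs.
  rewrite (_ : _ `&` _ = (U `&` F @^-1` V) `&` sphere R n).
    apply: (sphere_measure_open_gt0 oUV _ St); split; first exact: SU.
    by rewrite /= -rF//; exact: mem_set.
  apply/seteqP; split => x /= [].
    by move=> Sx; rewrite rF ?inE// => Vx; split => //; split => //; exact: SU.
  by move=> [Ux Vx] Sx; split => //; rewrite rF ?inE.
move=> hgt hlt t St; apply/eqP; rewrite eq_le; apply/andP.
split; rewrite leNgt; apply/negP => h.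
  suff : (r + rho t) / 2 < rho t.
    by move/(key _ _ (@open_gt _ _) St); apply; apply: hgt; lra.
  lra.
suff : rho t < (r + rho t) / 2.
  by move/(key _ _ (@open_lt _ _) St); apply; apply: hlt; lra.
lra.
Qed.

End graph_function.

End warped.

(** * Comparison of weighted volumes *)

(** The radius [r] is the one for which [B(r)] has the same volume as [Omega];
    it is common to both signs of [phi'' (alpha - 1)]. *)
Lemma weighted_volume_comparison (R : realType) (n : nat) (r0 : R) (rbar : \bar R)
  (phi : R -> R) (phi_smooth : smooth_on_hitv r0 rbar phi)
  (phi_gt0 : forall r, hitv r0 rbar r -> 0 < phi r)
  (dphi_gt0 : forall r, hitv r0 rbar r -> 0 < phi^`()%classic r)
  (rho : 'rV[R]_n.+1 -> R) (M_graphical : graphical r0 rbar rho) (alpha : R) :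
  let Omega := graph_domain r0 rho in
  exists r, [/\ hitv r0 rbar r,
    weighted_vol phi 1 Omega = weighted_vol phi 1 (rball n r0 r),
    (forall s, hitv r0 rbar s -> phi^`(2)%classic s * (alpha - 1) < 0) ->
      (weighted_vol phi alpha Omega <= weighted_vol phi alpha (rball n r0 r))%E /\
      (weighted_vol phi alpha Omega = weighted_vol phi alpha (rball n r0 r) ->
        Omega = rball n r0 r) &
    (forall s, hitv r0 rbar s -> 0 < phi^`(2)%classic s * (alpha - 1)) ->
      (weighted_vol phi alpha (rball n r0 r) <= weighted_vol phi alpha Omega)%E /\
      (weighted_vol phi alpha Omega = weighted_vol phi alpha (rball n r0 r) ->
        Omega = rball n r0 r)].
Proof.
move=> Omega.
have [sig sigE] := @sphere_measure_finite R n.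
have [M hM rhoM] := graph_function_max M_graphical.
have mrho := measurable_graph_function M_graphical.
have mS := @measurable_sphere R n.
have r0M : r0 <= M by have [] := hM.
have hitvM s : r0 <= s <= M -> hitv r0 rbar s.
  by move=> /andP[h1 h2]; exact: hitv_le hM.
have cw a : {within `[r0, M], continuous (weight n phi a)}.
  apply: continuous_in_subspaceT => s /set_mem/=; rewrite in_itv/= => /hitvM.
  exact: weight_continuous.
have w0 s : r0 <= s <= M -> 0 < weight n phi 1 s.
  by move=> /hitvM hs; exact: (weight_gt0 n phi_gt0 dphi_gt0).
have volE a u : measurable_fun (sphere R n) (u : _ -> measurableTypeR R) ->
    (forall t, sphere R n t -> u t <= M) ->
    weighted_vol phi a (slab (sphere R n) r0 u) =
    (\int[(@lebesgue_measure R \x sig)%E]_(p in slab (sphere R n) r0 u) weight n phi a p.1)%:E.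
  move=> mu_ uM; rewrite /weighted_vol sigE fineK//.
  have := integrable_fin_num (measurable_slab mS r0 mu_)
    (integrable_slab sig mS r0M (cw a) mu_ uM).
  exact.
have [r rM Vr] := slab_volume_attained sig mS r0M (cw 1) w0 mrho rhoM.
have rho_le t : sphere R n t -> rho t <= M by move=> /rhoM/andP[].
have r_le t : sphere R n t -> cst r t <= M by move=> _; case/andP: rM.
have mr : measurable_fun (sphere R n) (cst r : 'rV[R]_n.+1 -> measurableTypeR R).
  exact: measurable_cst.
have VOE a := volE a rho mrho rho_le.
have VBE a := volE a (cst r) mr r_le.
have OmegaE : (forall a, r < a -> sphere_measure (sphere R n `&` [set t | a < rho t]) = 0%E) /\
    (forall a, a < r -> sphere_measure (sphere R n `&` [set t | rho t < a]) = 0%E) ->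
    Omega = rball n r0 r.
  move=> [h1 h2]; have rhoE := graph_function_eq M_graphical h1 h2.
  by apply/seteqP; split => p [Sp]; [rewrite rhoE|rewrite -(rhoE _ Sp)].
exists r; split => //.
- exact: hitvM.
- by rewrite [LHS]VOE [RHS]VBE Vr.
- move=> hneg.
  have [s rs|s t r0s st tM|le_vol eq_vol] :=
    slab_weighted_volume_le (sig := sig) mS r0M (cw 1) (cw alpha) w0
      (w := fun s => phi^`()%classic s `^ (alpha - 1)) _ _ mrho rhoM rM Vr.
  + by apply: (weightE n dphi_gt0); exact: hitvM.
  + have ht : hitv r0 rbar t by apply: hitvM; rewrite tM (le_trans r0s (ltW st)).
    have hs : hitv r0 rbar s by apply: hitv_le ht => //; exact: ltW.
    apply: powR_lt_of_mul; [exact: dphi_gt0|exact: dphi_gt0|].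
    exact: dphi_scaled_decreasing hneg _ _ ht.
  rewrite [weighted_vol _ _ Omega]VOE [weighted_vol _ _ (rball _ _ _)]VBE lee_fin; split => //.
  by move=> -[/eq_vol]; rewrite -sigE; exact: OmegaE.
(* For an increasing ratio, the decreasing case is applied to [- g]. *)
move=> hpos.
have cNw : {within `[r0, M], continuous (fun s => - weight n phi alpha s)}.
  by move=> x; apply: continuousN; exact: cw.
have [s rs|s t r0s st tM|] := slab_weighted_volume_le (sig := sig) mS r0M (cw 1) cNw
  w0 (w := fun s => - phi^`()%classic s `^ (alpha - 1)) _ _ mrho rhoM rM Vr.
- by rewrite mulNr -(weightE n dphi_gt0)//; exact: hitvM.
- have ht : hitv r0 rbar t by apply: hitvM; rewrite tM (le_trans r0s (ltW st)).
  have hs : hitv r0 rbar s by apply: hitv_le ht => //; exact: ltW.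
  rewrite ltrN2; apply: powR_lt_of_mul; [exact: dphi_gt0|exact: dphi_gt0|].
  rewrite -ltrN2 -!mulNr; apply: dphi_scaled_decreasing ht => // x hx.
  by rewrite mulrN oppr_lt0 hpos.
have NE u : measurable_fun (sphere R n) (u : _ -> measurableTypeR R) ->
    (forall t, sphere R n t -> u t <= M) ->
    \int[(@lebesgue_measure R \x sig)%E]_(p in slab (sphere R n) r0 u)
      - weight n phi alpha p.1 =
    - \int[(@lebesgue_measure R \x sig)%E]_(p in slab (sphere R n) r0 u)
        weight n phi alpha p.1.
  move=> mu_ uM; under eq_Rintegral do rewrite -mulN1r.
  by rewrite RintegralZl ?mulN1r//; [exact: measurable_slab|exact: integrable_slab uM].
rewrite !NE// lerN2 => le_vol eq_vol.
rewrite [weighted_vol _ _ Omega]VOE [weighted_vol _ _ (rball _ _ _)]VBE lee_fin; split => //.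
by move=> -[/(congr1 -%R)/eq_vol]; rewrite -sigE; exact: OmegaE.
Qed.

Unset Implicit Arguments.
Set Strict Implicit.
Set Printing Implicit Defensive.

Theorem corollary1p6 (R : realType) (n : nat) (hn : (1 <= n)%N)
  (r0 : R) (hr0 : 0 <= r0) (rbar : \bar R) (hrbar : (r0%:E < rbar)%E)
  (phi : R -> R) (phi_smooth : smooth_on_hitv r0 rbar phi)
  (phi_gt0 : forall r, hitv r0 rbar r -> 0 < phi r)
  (dphi_gt0 : forall r, hitv r0 rbar r -> 0 < phi^`()%classic r)
  (phi_cond : forall r, hitv r0 rbar r ->
     0 <= phi^`()%classic r ^+ 2 - phi r * phi^`(2)%classic r)
  (rho : 'rV[R]_n.+1 -> R) (M_graphical : graphical r0 rbar rho)
  (alpha : R) (xi : \bar R -> \bar R)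
  (hxi : is_xi n phi r0 rbar alpha xi) :
  let Omega := graph_domain r0 rho in
  let VOmega_alpha := weighted_vol phi alpha Omega in
  let VOmega := weighted_vol phi 1 Omega in
  ((forall r, hitv r0 rbar r -> phi^`(2)%classic r * (alpha - 1) < 0) ->
     (VOmega_alpha <= xi VOmega)%E /\
     (VOmega_alpha = xi VOmega <->
        exists2 r, hitv r0 rbar r & Omega = rball n r0 r)) /\
  ((forall r, hitv r0 rbar r -> 0 < phi^`(2)%classic r * (alpha - 1)) ->
     (xi VOmega <= VOmega_alpha)%E /\
     (VOmega_alpha = xi VOmega <->
        exists2 r, hitv r0 rbar r & Omega = rball n r0 r)).
Proof.
move=> Omega VOmega_alpha VOmega.
have [r [hr VE neg pos]] :=
  weighted_volume_comparison phi_smooth phi_gt0 dphi_gt0 M_graphical alpha.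
have xiE : xi VOmega = weighted_vol phi alpha (rball n r0 r).
  by rewrite /VOmega VE hxi.
have ball_eq : (exists2 s, hitv r0 rbar s & Omega = rball n r0 s) -> VOmega_alpha = xi VOmega.
  by move=> [s hs OE]; rewrite /VOmega_alpha /VOmega OE hxi.
split=> [/neg|/pos] [le_vol eq_vol]; rewrite xiE; split => //.
  by split=> [/eq_vol ?|/ball_eq ->]; [exists r|exact: xiE].
by split=> [/eq_vol ?|/ball_eq ->]; [exists r|exact: xiE].
Qed.
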